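(* Let $K$ be a field and let $P \subset \mathbb{R}^d$ be a lattice polytope such that every edge of $P$ is primitive. Let $\{\mathbf{a}_1,\dots,\mathbf{a}_m\}$ be the vertex set of $P$ and let $P\cap\mathbb{Z}^d=\{\mathbf{a}_1,\dots,\mathbf{a}_n\}$ with $m\le n$ (all $\mathbf{a}_i$ distinct). If every binomial in $I_P\cap K[x_1,\dots,x_m]$ is generated by quadratic binomials in $I_P$ (i.e. lies in the ideal of $K[x_1,\dots,x_n]$ generated by the quadratic binomials belonging to $I_P$), then every clique of the $1$-skeleton $\mathrm{sk}(P)$ is the vertex set of a face of $P$.
   Context: A lattice polytope in $\mathbb{R}^d$ is a convex polytope all of whose vertices lie in $\mathbb{Z}^d$. A segment with endpoints in $\mathbb{Z}^d$ is primitive if its only lattice points are its two endpoints. The $1$-skeleton $\mathrm{sk}(P)$ is the finite simple graph whose vertices are the vertices of $P$, with two distinct vertices $v,w$ adjacent iff $\mathrm{conv}(\{v,w\})$ is an edge ($1$-dimensional face) of $P$. A clique of a graph is the vertex set of a complete subgraph. $P$ itself is regarded as a face of $P$. The toric ideal $I_P$ is the kernel of the $K$-algebra homomorphism $\pi : K[x_1,\dots,x_n] \to K[t_1^{\pm1},\dots,t_d^{\pm 1},s]$, $\pi(x_i)=\mathbf{t}^{\mathbf{a}_i}s$, where $\mathbf{t}^{\mathbf{a}}=t_1^{a_1}\cdots t_d^{a_d}$ for $\mathbf{a}=(a_1,\dots,a_d)$. A binomial is a difference of two distinct monomials (each with coefficient $1$); a quadratic binomial is a homogeneous binomial of degree $2$.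 *)

(* Defs.v *)
From HB Require Import structures.
From mathcomp Require Import all_boot all_order all_algebra.
From mathcomp Require Import boolp classical_sets functions cardinality reals.
From mathcomp Require Import mpoly.

Set Implicit Arguments.
Unset Strict Implicit.
Unset Printing Implicit Defensive.

Import Order.TTheory GRing.Theory Num.Theory.

Local Open Scope classical_set_scope.
Local Open Scope ring_scope.

Section Polytopes.
Context {R : realType} {d : nat}.
Implicit Types (A F P : set 'rV[R]_d) (v w x : 'rV[R]_d).

Definition conv_hull A : set 'rV[R]_d :=
  [set x | exists k (p : 'I_k -> 'rV[R]_d) (c : 'I_k -> R),
     [/\ forall i, A (p i), forall i, 0 <= c i, \sum_i c i = 1
       & x = \sum_i c i *: p i]].

Definition aff_hull A : set 'rV[R]_d :=
  [set x | exists k (p : 'I_k -> 'rV[R]_d) (c : 'I_k -> R),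
     [/\ forall i, A (p i), \sum_i c i = 1 & x = \sum_i c i *: p i]].

Definition has_dim A (k : nat) : Prop :=
  exists x (V : 'M[R]_(k, d)),
    row_free V /\ aff_hull A = range (fun u : 'rV[R]_k => x + u *m V).

Definition polytope P : Prop :=
  exists2 A : set 'rV[R]_d, finite_set A & P = conv_hull A.

(* Taking c = 0 shows that P itself (b = 0) and the empty set (b = 1) are
   faces of P. *)
Definition face P F : Prop :=
  exists (c : 'cV[R]_d) (b : R),
    (forall x, P x -> (x *m c) 0 0 <= b) /\
    F = P `&` [set x | (x *m c) 0 0 = b].

Definition vertices P : set 'rV[R]_d := [set v | face P [set v]].

Definition edge P F : Prop := face P F /\ has_dim F 1.

Definition of_lattice (z : 'rV[int]_d) : 'rV[R]_d := map_mx intr z.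

Definition lattice : set 'rV[R]_d := range of_lattice.

Definition lattice_polytope P : Prop := polytope P /\ vertices P `<=` lattice.

Definition primitive_segment A : Prop :=
  exists v w, [/\ lattice v, lattice w, v <> w, A = conv_hull [set v; w]
                & A `&` lattice = [set v; w]].

Definition skeleton_adj P v w : Prop :=
  [/\ vertices P v, vertices P w, v <> w & edge P (conv_hull [set v; w])].

Definition skeleton_clique P (C : set 'rV[R]_d) : Prop :=
  C `<=` vertices P /\
  forall v w, C v -> C w -> v <> w -> skeleton_adj P v w.

End Polytopes.

Arguments lattice {R d}.

Section ToricIdeals.
Context {K : fieldType}.

(* K[t_1^{+-1}, ..., t_d^{+-1}, s] is realised inside the field of fractions
   of K[t_1, ..., t_d, s]; enlarging the codomain of pi to this field does not
   change its kernel. *)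
Section Map.
Context {d n : nat} (a : 'I_n -> 'rV[int]_d).

Let L : fieldType := {fraction {mpoly K[d.+1]}}.

Definition laurent_const : K -> L :=
  @FracField.tofrac {mpoly K[d.+1]} \o @mpolyC d.+1 K.

HB.instance Definition _ := GRing.RMorphism.on laurent_const.

Definition laurent_t (j : 'I_d) : L :=
  FracField.tofrac 'X_(widen_ord (leqnSn d) j).

Definition laurent_s : L := FracField.tofrac 'X_ord_max.

Definition toric_map : {mpoly K[n]} -> L :=
  mmap laurent_const
    (fun i => (\prod_(j < d) laurent_t j ^ (a i 0 j)) * laurent_s).

HB.instance Definition _ := GRing.RMorphism.on toric_map.

Definition toric_ideal : set {mpoly K[n]} := [set p | toric_map p = 0].

End Map.

Context {n : nat}.

(* The subring K[x_1, ..., x_m] of K[x_1, ..., x_n] *)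
Definition first_vars (m : nat) : set {mpoly K[n]} :=
  [set p | forall u : 'X_{1..n}, u \in msupp p ->
             forall i : 'I_n, (m <= i)%N -> u i = 0%N].

Definition is_binomial : set {mpoly K[n]} :=
  [set p | exists u v : 'X_{1..n}, u <> v /\ p = 'X_[u] - 'X_[v]].

Definition is_quadratic_binomial : set {mpoly K[n]} :=
  is_binomial `&` [set p | p \is 2.-homog].

Definition ideal_gen (G : set {mpoly K[n]}) : set {mpoly K[n]} :=
  [set p | exists k (g c : 'I_k -> {mpoly K[n]}),
     (forall i, G (g i)) /\ p = \sum_i c i * g i].

End ToricIdeals.

(* Main.v *)
Require Import Defs.
From HB Require Import structures.
From mathcomp Require Import all_boot all_order all_algebra.
From mathcomp Require Import boolp classical_sets functions cardinality reals.
From mathcomp Require Import mpoly.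

Set Implicit Arguments.
Unset Strict Implicit.
Unset Printing Implicit Defensive.

Import Order.TTheory GRing.Theory Num.Theory.

Local Open Scope classical_set_scope.
Local Open Scope ring_scope.

(** Suppose that a clique C of the 1-skeleton is not the vertex set of a face.
    By linear duality over the rationals, the absence of a functional that is
    constant on C and strictly smaller on the other vertices yields an affine
    relation between vertices in which some vertex outside C has a positive
    coefficient and every negative coefficient belongs to C.  Clearing
    denominators and moving the negative terms to the other side gives two
    distinct monomials x^u and x^v in the variables of the vertices, u being
    supported on C, with x^u - x^v in the toric ideal
    ([supporting_functional_or_relation], [toric_binomialP]).

    If x^u - x^v lies in the ideal generated by quadratic binomials of the toric
    ideal, then x^u is divisible by a monomial x_i x_j of one of them
    ([ideal_gen_msupp_divisor]), so that a_i + a_j = a_k + a_l with a_i, a_j in C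
    and {k, l} <> {i, j}.  But conv(a_i, a_j) is a vertex or a primitive edge of
    P; being a face, it contains a_k and a_l along with the midpoint that they
    share with a_i and a_j, and its only lattice points are a_i and a_j.  Hence
    {k, l} = {i, j}, a contradiction ([clique_pair_sum]).

    So a functional exists.  As P is the convex hull of its vertices
    ([polytope_sub_conv_vertices]), this functional supports P along a face whose
    vertices are exactly the points of C ([vertices_supporting_face]).

    The same theorem of the alternative, Gordan's ([gordan]), serves twice: over
    the reals to show that a point outside the hull of the other generators is a
    vertex, and over the rationals, where it makes the relation integral. *)

(** * A theorem of the alternative *)

Definition dotp (F : pzRingType) (d : nat) (x : 'rV[F]_d) (c : 'cV[F]_d) : F :=
  (x *m c) 0 0.

Lemma dotpZl (F : pzRingType) d k (x : 'rV[F]_d) c :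
  dotp (k *: x) c = k * dotp x c.
Proof. by rewrite /dotp -scalemxAl mxE. Qed.

Lemma dotpBl (F : pzRingType) d (x y : 'rV[F]_d) c :
  dotp (x - y) c = dotp x c - dotp y c.
Proof. by rewrite /dotp mulmxBl !mxE. Qed.

Lemma dotpDl (F : pzRingType) d (x y : 'rV[F]_d) c :
  dotp (x + y) c = dotp x c + dotp y c.
Proof. by rewrite /dotp mulmxDl !mxE. Qed.

Lemma dotpZDr (F : comPzRingType) d k (x : 'rV[F]_d) c c' :
  dotp x (k *: c + c') = k * dotp x c + dotp x c'.
Proof. by rewrite /dotp mulmxDr -scalemxAr !mxE. Qed.

Lemma dotp_suml (F : pzRingType) (I : Type) (r : seq I) d (c : I -> F)
    (w : I -> 'rV[F]_d) (y : 'cV[F]_d) :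
  dotp (\sum_(i <- r) c i *: w i) y = \sum_(i <- r) c i * dotp (w i) y.
Proof.
rewrite /dotp mulmx_suml summxE; apply: eq_bigr => i _.
by rewrite -scalemxAl mxE.
Qed.

Lemma exists_between (F : realFieldType) (s : seq F) (y : F) :
  {in s, forall z, z < y} -> exists2 x, x < y & {in s, forall z, z < x}.
Proof.
elim: s => [|z s IHs] lt_s_y.
  by exists (y - 1) => //; rewrite ltrBlDr ltrDl.
have [|x lt_xy lt_s_x] := IHs.
  by move=> t ts; apply: lt_s_y; rewrite inE ts orbT.
have lt_zy : z < y by apply: lt_s_y; rewrite mem_head.
exists ((Num.max z x + y) / 2); first by rewrite midf_lt // gt_max lt_zy.
have lt_max : Num.max z x < (Num.max z x + y) / 2.
  by rewrite midf_lt // gt_max lt_zy.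
move=> t; rewrite inE => /predU1P[->|/lt_s_x lt_tx].
  by apply: le_lt_trans lt_max; rewrite le_max lexx.
by apply: le_lt_trans lt_max; rewrite le_max (ltW lt_tx) orbT.
Qed.

(** Gordan's theorem, by induction on the number of vectors.  Let [c] be positive
    on all vectors but [w k], with [t <= 0] its value there.  The vectors
    [w' i = dotp (w i) c *: w k - t *: w i] are orthogonal to [c] and are
    nonnegative combinations of [w k] and [w i], so a relation between them
    unfolds to a relation between the [w i].  If instead some [c'] is positive on
    all of them, then [x *: c + c'] is positive on every [w i] for a suitable
    scalar [x]. *)
Lemma gordan (F : realFieldType) (I : eqType) (s : seq I) (d : nat)
    (w : I -> 'rV[F]_d) :
  uniq s ->
  (exists c : 'cV[F]_d, {in s, forall i, 0 < dotp (w i) c}) \/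
  (exists mu : I -> F, [/\ forall i, 0 <= mu i, exists2 i, i \in s & 0 < mu i
    & \sum_(i <- s) mu i *: w i = 0]).
Proof.
elim: s w => [|k s IHs] w /=; first by left; exists 0.
case/andP=> ks us; have [[c c_pos]|[mu [mu0 [i si mui] sum_mu]]] := IHs w us;
    last first.
  right; exists (fun j => if j == k then 0 else mu j); split.
  - by move=> j; case: ifP.
  - exists i; rewrite ?inE ?si ?orbT //.
    by case: eqP => // eik; rewrite -eik si in ks.
  - rewrite big_cons eqxx scale0r add0r -[RHS]sum_mu; apply: eq_big_seq => j sj.
    by case: eqP => // ejk; rewrite -ejk sj in ks.
have [tpos|] := ltP 0 (dotp (w k) c).
  by left; exists c => i; rewrite inE => /predU1P[->|/c_pos].
set t := dotp (w k) c => t_le0.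
pose w' i := dotp (w i) c *: w k - t *: w i.
have dot_w' i y : dotp (w' i) y = dotp (w i) c * dotp (w k) y - t * dotp (w i) y.
  by rewrite dotpBl !dotpZl.
have [[c' c'_pos]|[mu [mu0 [i si mui] sum_mu]]] := IHs w' us; last first.
  right; exists (fun j => if j == k then \sum_(i <- s) mu i * dotp (w i) c
                          else mu j * - t).
  have sum_ge0 : 0 <= \sum_(i <- s) mu i * dotp (w i) c.
    by rewrite big_seq; apply: sumr_ge0 => j sj; rewrite mulr_ge0 // ltW ?c_pos.
  split.
  - by move=> j; case: ifP => // _; rewrite mulr_ge0 ?oppr_ge0.
  - exists k; rewrite ?mem_head // eqxx (big_rem i) //=.
    rewrite ltr_wpDr ?mulr_gt0 ?c_pos // big_seq sumr_ge0 // => j /mem_rem sj.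
    by rewrite mulr_ge0 // ltW ?c_pos.
  - rewrite big_cons eqxx -[RHS]sum_mu scaler_suml -big_split /=.
    apply: eq_big_seq => j sj.
    case: eqP => [ejk|_]; first by rewrite -ejk sj in ks.
    by rewrite scalerBr !scalerA mulrN scaleNr.
(* The correction of [c] is sought in the form [x *: c + u]. *)
have lift x u : (forall i, i \in s -> 0 < x * dotp (w i) c + dotp (w i) u) ->
    0 < x * t + dotp (w k) u ->
  exists c, {in k :: s, forall i, 0 < dotp (w i) c}.
  move=> s_pos k_pos; exists (x *: c + u) => i.
  by rewrite dotpZDr inE => /predU1P[->|/s_pos].
move: t_le0; rewrite le_eqVlt => /orP[/eqP t0|t_lt0].
  have [wk0|wk_neq0] := eqVneq (w k) 0.
    right; exists (fun j => (j == k)%:R); split.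
    - by move=> j; rewrite ler0n.
    - by exists k; rewrite ?mem_head // eqxx.
    - rewrite big_cons wk0 scaler0 add0r big1_seq // => j /andP[_ sj].
      by case: eqP => [ejk|]; rewrite ?scale0r // -ejk sj in ks *.
  have wk_pos : 0 < dotp (w k) (w k)^T.
    rewrite /dotp mxE lt_def sumr_ge0 => [|j _]; last by rewrite mxE -expr2 sqr_ge0.
    rewrite andbT; apply: contraNneq wk_neq0 => /eqP.
    rewrite psumr_eq0 => [/allP w0|j _]; last by rewrite mxE -expr2 sqr_ge0.
    apply/eqP/rowP => j; move: (w0 j (mem_index_enum j)).
    by rewrite !mxE mulf_eq0 orbb => /eqP.
  (* [c] vanishes on [w k], so adding a large multiple of [c] to a functional
     positive on [w k] makes it positive on all the vectors. *)
  pose ratio i := - dotp (w i) (w k)^T / dotp (w i) c.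
  have [x _ lt_x] : exists2 x, x < 1 + \sum_(i <- s) `|ratio i| &
      {in map ratio s, forall z, z < x}.
    apply: exists_between => _ /mapP[i si ->].
    rewrite (big_rem i) //= addrCA; apply: le_lt_trans (ler_norm _) _.
    by rewrite ltrDl ltr_wpDr ?sumr_ge0 ?ltr01.
  left; apply: (lift x (w k)^T); last by rewrite t0 mulr0 add0r.
  move=> i si; have := lt_x _ (map_f ratio si).
  by rewrite ltr_pdivrMr ?c_pos // -subr_gt0 opprK.
(* Positivity on [w i] bounds [x] from below and positivity on [w k] from above;
   positivity of [c'] on [w' i] says that these bounds are compatible. *)
pose ratio i := - dotp (w i) c' / dotp (w i) c.
have [x x_lt lt_x] : exists2 x, x < dotp (w k) c' / - t &
    {in map ratio s, forall z, z < x}.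
  apply: exists_between => _ /mapP[i si ->].
  have := c'_pos i si; rewrite dot_w' => q_pos.
  rewrite ltr_pdivrMr ?c_pos // mulrAC ltr_pdivlMr ?oppr_gt0 //.
  by rewrite mulrNN -subr_gt0 [X in X - _]mulrC [X in _ - X]mulrC.
left; apply: (lift x c').
  move=> i si; have := lt_x _ (map_f ratio si).
  by rewrite ltr_pdivrMr ?c_pos // -subr_gt0 opprK.
by move: x_lt; rewrite ltr_pdivlMr ?oppr_gt0 // mulrN -subr_gt0 opprK addrC.
Qed.

(** * Polytopes and their faces *)

Lemma weighted_mean_le (F : realFieldType) (I : eqType) (r : seq I)
    (nu f : I -> F) (b : F) :
  (forall i, 0 <= nu i) -> \sum_(i <- r) nu i = 1 ->
  {in r, forall i, f i <= b} -> \sum_(i <- r) nu i * f i <= b.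
Proof.
move=> nu_ge0 nu1 f_le; rewrite -[leRHS]mul1r -nu1 mulr_suml.
by rewrite big_seq [leRHS]big_seq; apply: ler_sum => i ri; rewrite ler_wpM2l ?f_le.
Qed.

Lemma weighted_mean_eq (F : realFieldType) (I : eqType) (r : seq I)
    (nu f : I -> F) (b : F) :
  (forall i, 0 <= nu i) -> \sum_(i <- r) nu i = 1 ->
  {in r, forall i, f i <= b} -> \sum_(i <- r) nu i * f i = b ->
  {in r, forall i, nu i != 0 -> f i = b}.
Proof.
move=> nu_ge0 nu1 f_le mean_eq.
have : \sum_(i <- r) nu i * (b - f i) = 0.
  under eq_bigr do rewrite mulrBr.
  by rewrite sumrB -mulr_suml nu1 mul1r mean_eq subrr.
rewrite big_seq => /eqP; rewrite psumr_eq0 => [/allP zero i ri nui|i ri].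
  move: (zero i ri); rewrite ri /= mulf_eq0 (negPf nui) subr_eq0.
  by move/eqP.
by rewrite mulr_ge0 // subr_ge0 f_le.
Qed.

Section Polytopes.
Context {R : realType} {d : nat}.
Implicit Types (A F P : set 'rV[R]_d) (s : seq 'rV[R]_d) (v w x y : 'rV[R]_d).

Lemma sub_conv_hull A x : A x -> conv_hull A x.
Proof.
move=> Ax; exists 1%N, (fun=> x), (fun=> 1).
by split=> //; rewrite big_ord1 ?scale1r.
Qed.

Lemma conv_hullS A B : A `<=` B -> conv_hull A `<=` conv_hull B.
Proof.
by move=> sAB x [k [p [c [Ap c0 c1 ->]]]]; exists k, p, c; split=> // i; apply: sAB.
Qed.

(** Coefficients indexed by the points themselves: repeated points in a convex
    combination are merged, which makes combinations easy to substitute into one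
    another. *)
Lemma conv_hull_seqP s x : uniq s ->
  conv_hull [set` s] x <-> exists mu : 'rV[R]_d -> R,
    [/\ forall p, 0 <= mu p, \sum_(p <- s) mu p = 1
      & x = \sum_(p <- s) mu p *: p].
Proof.
move=> us; split=> [[k [p [c [sp c0 c1 ->]]]]|[mu [mu0 mu1 ->]]]; last first.
  exists (size s), (tnth (in_tuple s)), (mu \o tnth (in_tuple s)).
  split=> [i|i||]; first exact: mem_tnth.
  - exact: mu0.
  - by rewrite -[RHS]mu1 [RHS]big_tnth.
  - by rewrite big_tnth.
have regroup (V : lmodType R) (h : 'rV[R]_d -> V) :
    \sum_(q <- s) (\sum_(i | p i == q) c i) *: h q = \sum_i c i *: h (p i).
  under eq_bigr do rewrite scaler_suml.
  rewrite (exchange_big_dep predT) //=; apply: eq_bigr => i _.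
  rewrite -big_filter (_ : filter _ _ = [:: p i]) ?big_seq1 //.
  rewrite -(filter_pred1_uniq us (sp i)); apply: eq_filter => q.
  by rewrite /= eq_sym.
exists (fun q => \sum_(i | p i == q) c i); split.
- by move=> q; rewrite sumr_ge0.
- rewrite -[RHS]c1; have := regroup R^o (fun=> 1).
  by under eq_bigr do rewrite [_ *: _]mulr1; under [in RHS]eq_bigr do rewrite [_ *: _]mulr1.
- by rewrite regroup.
Qed.

Lemma conv_hull_rem s a : uniq s -> a \in s -> conv_hull [set` rem a s] a ->
  conv_hull [set` s] = conv_hull [set` rem a s].
Proof.
move=> us sa; have us' := rem_uniq a us.
move/(conv_hull_seqP _ us') => [nu [nu0 nu1 a_nu]].
apply/seteqP; split; last by apply: conv_hullS => p; apply: mem_rem.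
move=> x /(conv_hull_seqP _ us)[mu [mu0 mu1 ->]].
apply/(conv_hull_seqP _ us'); exists (fun p => mu a * nu p + mu p); split.
- by move=> p; rewrite addr_ge0 ?mulr_ge0.
- by rewrite big_split -mulr_sumr nu1 mulr1 -[RHS]mu1 [RHS](big_rem a).
- rewrite [LHS](big_rem a) //= {2}a_nu scaler_sumr -big_split.
  by apply: eq_bigr => p _; rewrite scalerA scalerDl.
Qed.

(** Gordan's alternative for the vectors [a - p]: a nonnegative relation between
    them would, after normalisation, write [a] as a convex combination of the
    other points, so some functional is larger at [a] than at every other point. *)
Lemma vertex_of_notin_conv_hull s a : uniq s -> a \in s ->
  ~ conv_hull [set` rem a s] a -> vertices (conv_hull [set` s]) a.
Proof.
move=> us sa not_conv; have us' := rem_uniq a us.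
have [[c c_pos]|[mu [mu0 [i si mui] sum_mu]]] := gordan (fun p => a - p) us';
    last first.
  have M_gt0 : 0 < \sum_(p <- rem a s) mu p.
    by rewrite (big_rem i) //= ltr_wpDr ?sumr_ge0.
  case: not_conv; apply/(conv_hull_seqP _ us').
  exists (fun p => (\sum_(p <- rem a s) mu p)^-1 * mu p); split.
  - by move=> p; rewrite mulr_ge0 // invr_ge0 ltW.
  - by rewrite -mulr_sumr mulVf // gt_eqF.
  - under eq_bigr do rewrite -scalerA.
    apply: (scalerI (lt0r_neq0 M_gt0)); rewrite -scaler_sumr scalerA.
    rewrite divff ?gt_eqF // scale1r; apply/eqP; rewrite -subr_eq0; apply/eqP.
    by rewrite -[RHS]sum_mu scaler_suml -sumrB; under eq_bigr do rewrite -scalerBr.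
have lt_c p : p \in s -> p != a -> dotp p c < dotp a c.
  by move=> sp p_a; rewrite -subr_gt0 -dotpBl c_pos // mem_rem_uniq // !inE p_a.
have le_c : {in s, forall p, dotp p c <= dotp a c}.
  by move=> p sp; have [->//|/(lt_c _ sp)/ltW] := eqVneq p a.
exists c, (dotp a c); split.
  move=> x /(conv_hull_seqP _ us)[mu [mu0 mu1 ->]].
  by rewrite -/(dotp _ _) dotp_suml weighted_mean_le.
apply/seteqP; split=> [_ ->|x /= [/(conv_hull_seqP _ us)[mu [mu0 mu1 ->]]]].
  by split=> //; apply: sub_conv_hull.
rewrite -/(dotp _ _) dotp_suml => mean_eq.
rewrite -[RHS]scale1r -mu1 scaler_suml; apply: eq_big_seq => p sp.
have [->|mup] := eqVneq (mu p) 0; first by rewrite !scale0r.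
have := weighted_mean_eq mu0 mu1 le_c mean_eq sp mup.
by have [->//|/(lt_c _ sp)] := eqVneq p a => /lt_eqF/eqP.
Qed.

(** Redundant generators can be discarded one at a time; in an irredundant list
    every generator is a vertex. *)
Lemma polytope_sub_conv_vertices P :
  polytope P -> P `<=` conv_hull (vertices P).
Proof.
case=> A /finite_seqP[s0 ->].
rewrite (_ : [set` s0] = [set` undup s0]); last first.
  by apply/seteqP; split=> x /=; rewrite mem_undup.
move: (undup s0) (undup_uniq s0) => {s0} s us P_s.
have [n] := ubnP (size s); elim: n s us P_s => // n IHn s us P_s lt_sn.
have [[a sa a_red]|irredundant] :=
    pselect (exists2 a, a \in s & conv_hull [set` rem a s] a).
  apply: (IHn (rem a s)); first exact: rem_uniq.
    by rewrite P_s; apply: conv_hull_rem.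
  by rewrite size_rem //; case: (s) sa lt_sn.
rewrite {1}P_s; apply: conv_hullS => a sa; rewrite P_s.
by apply: vertex_of_notin_conv_hull => // a_red; apply: irredundant; exists a.
Qed.

(** A functional bounded by [b] at [x] and [y] cannot have sum [b + b] there
    without reaching [b] at both. *)
Lemma face_sum_closed P F x y v w : face P F -> P x -> P y -> F v -> F w ->
  x + y = v + w -> F x.
Proof.
move=> [c [b [c_le ->]]] Px Py [_ /= vb] [_ /= wb] xy_vw; split=> //=.
have := congr1 (fun z => dotp z c) xy_vw; rewrite !dotpDl /dotp vb wb => xy_bb.
have := c_le _ Px; have := c_le _ Py.
rewrite -[x in _ -> _ -> x]/(_ = _) => yb xb; apply/eqP; rewrite eq_le xb /=.
by rewrite -(lerD2r ((y *m c) 0 0)) xy_bb lerD2l.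
Qed.

(** The midpoint of [v] and [w] lies on a face whose only lattice points are [v]
    and [w]: the vertex itself if [v = w], and otherwise a primitive edge. *)
Lemma clique_pair_sum P (C : set 'rV[R]_d) x y v w :
  (forall F, edge P F -> primitive_segment F) -> skeleton_clique P C ->
  (P `&` lattice) x -> (P `&` lattice) y -> C v -> C w ->
  lattice v -> lattice w -> x + y = v + w -> x = v \/ x = w.
Proof.
move=> prim [CV Cadj] [Px Lx] [Py Ly] Cv Cw Lv Lw xy_vw.
have [vw|v_neq_w] := pselect (v = w).
  by left; apply: (face_sum_closed (CV v Cv) Px Py (erefl v) _ xy_vw).
have [_ _ _ edge_vw] := Cadj v w Cv Cw v_neq_w.
have [face_vw _] := edge_vw.
have Fv : conv_hull [set v; w] v by apply: sub_conv_hull; left.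
have Fw : conv_hull [set v; w] w by apply: sub_conv_hull; right.
have Fx := face_sum_closed face_vw Px Py Fv Fw xy_vw.
have [v' [w' [_ _ _ _ latE]]] := prim _ edge_vw.
have : [set v'; w'] x by rewrite -latE.
have : [set v'; w'] v by rewrite -latE.
have : [set v'; w'] w by rewrite -latE.
by move=> [wE|wE] [vE|vE] [xE|xE]; first [left; congruence | right; congruence].
Qed.

(** The supported face is the convex hull of [C]: a convex combination of vertices
    of [P] reaches the maximum [b] only if all the vertices that it really uses
    do, and these lie in [C].  The argument applied once more, to the functional
    exposing a vertex of the face, shows that this vertex is one of them. *)
Lemma vertices_supporting_face (C : set 'rV[R]_d) P c b :
  polytope P -> C `<=` vertices P ->
  (forall v, C v -> dotp v c = b) ->
  (forall v, vertices P v -> ~ C v -> dotp v c < b) ->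
  exists2 F : set 'rV[R]_d, face P F & vertices F = C.
Proof.
move=> polyP CV Cb Vb.
have VP v : vertices P v -> P v.
  by move=> [c0 [b0 [_ vE]]]; have : [set v] v by []; rewrite {1}vE => -[].
have V_le v : vertices P v -> dotp v c <= b.
  by move=> Vv; have [/Cb->//|/(Vb v Vv)/ltW] := pselect (C v).
pose F := P `&` [set x | (x *m c) 0 0 = b].
have CF v : C v -> F v by move=> Cv; split; [apply/VP/CV | apply: Cb].
exists F.
  exists c, b; split=> // x /(polytope_sub_conv_vertices polyP).
  move=> [k [p [nu [Vp nu0 nu1 ->]]]]; rewrite -/(dotp _ _) dotp_suml.
  by apply: weighted_mean_le => // i _; apply: V_le.
apply/seteqP; split=> v; last first.
  move=> Cv; have [c0 [b0 [c0_le vE]]] := CV v Cv.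
  exists c0, b0; split=> [x [Px _]|]; first exact: c0_le.
  rewrite -/F; apply/seteqP; split=> [_ ->|x [[Px _] xb]].
    by split; [exact: CF | have : [set v] v by []; rewrite {1}vE => -[]].
  by rewrite vE.
move=> [c0 [b0 [c0_le vE]]].
have [[Pv vb] vb0] : (F `&` [set x | (x *m c0) 0 0 = b0]) v by rewrite -vE.
have [k [p [nu [Vp nu0 nu1 v_nu]]]] := polytope_sub_conv_vertices polyP Pv.
have p_face i : nu i != 0 -> C (p i).
  move=> nui; have [//|not_Cp] := pselect (C (p i)).
  move: vb => /=; rewrite -/(dotp _ _) v_nu dotp_suml => mean_eq.
  have := weighted_mean_eq nu0 nu1 (fun i _ => V_le _ (Vp i)) mean_eq
    (mem_index_enum i) nui.
  by move=> /eqP; rewrite lt_eqF // Vb.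
have [i nui] : exists i, nu i != 0.
  apply/existsP; apply: contraT; rewrite negb_exists => /forallP nu_0.
  by move/eqP: nu1; rewrite big1 ?(eq_sym 0) ?oner_eq0 // => i _; apply/eqP;
     have := nu_0 i; rewrite negbK.
suff <- : p i = v by apply: p_face.
(* Points of zero weight may lie outside the face, where [c0] is not bounded by
   [b0], so their values are replaced. *)
pose f i := if nu i == 0 then b0 else dotp (p i) c0.
have f_le : {in index_enum 'I_k, forall i, f i <= b0}.
  by move=> j _; rewrite /f; case: eqP => // /eqP /p_face /CF; apply: c0_le.
have mean_eq : \sum_i nu i * f i = b0.
  rewrite -[RHS]vb0 -/(dotp _ _) v_nu dotp_suml; apply: eq_bigr => j _.
  by rewrite /f; case: eqP => // ->; rewrite !mul0r.
have := weighted_mean_eq nu0 nu1 f_le mean_eq (mem_index_enum i) nui.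
rewrite /f (negPf nui) => pi_b0.
have : [set v] (p i) by rewrite vE; split=> //; apply/CF/p_face.
by [].
Qed.

End Polytopes.

(** * Toric ideals and quadratic binomials *)

Local Notation tofrac := (@FracField.tofrac _).

(** Multiplying by a monomial that clears all the negative exponents reduces this
    to the distinctness of monomials in the polynomial ring. *)
Lemma laurent_monomial_inj (K : fieldType) (n : nat) (e e' : 'I_n -> int) :
  \prod_i (tofrac ('X_i : {mpoly K[n]})) ^ e i
    = \prod_i (tofrac ('X_i : {mpoly K[n]})) ^ e' i ->
  e =1 e'.
Proof.
have X_neq0 i : tofrac ('X_i : {mpoly K[n]}) != 0.
  by rewrite tofrac_eq0 -msupp_eq0 msuppX.
pose N i : int := `|e i| + `|e' i|.
have shift (h : 'I_n -> int) : (forall i, 0 <= h i + N i) ->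
    (\prod_i (tofrac ('X_i : {mpoly K[n]})) ^ h i)
      * \prod_i (tofrac ('X_i : {mpoly K[n]})) ^ N i
    = tofrac 'X_[ [multinom absz (h i + N i)%R | i < n] ].
  move=> h_ge; rewrite -big_split mpolyXE_id rmorph_prod /=.
  apply: eq_bigr => i _.
  by rewrite -expfzDr // mnmE rmorphXn /= -{1}(gez0_abs (h_ge i)).
have e_ge i : 0 <= e i + N i.
  by rewrite /N addrA addr_ge0 // -lerBlDl sub0r -normrN ler_norm.
have e'_ge i : 0 <= e' i + N i.
  by rewrite /N addrCA addr_ge0 // -lerBlDl sub0r -normrN ler_norm.
move=> e_e'; have := shift e e_ge; rewrite e_e' shift // => /eqP.
rewrite tofrac_eq => /eqP /(congr1 (mcoeff [multinom absz (e i + N i)%R | i < n])).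
rewrite !mcoeffX eqxx; case: eqP => [E _ i|_ /eqP]; last first.
  by rewrite eq_sym oner_eq0.
move/(congr1 (fun u : 'X_{1..n} => u i)): E; rewrite !mnmE => E.
by apply: (addIr (N i)); rewrite -(gez0_abs (e_ge i)) -(gez0_abs (e'_ge i)) E.
Qed.

Lemma toric_mapX (K : fieldType) (d n : nat) (a : 'I_n -> 'rV[int]_d)
    (u : 'X_{1..n}) :
  toric_map (K := K) a 'X_[u]
  = (\prod_(j < d) laurent_t (K := K) j ^ (\sum_i a i 0 j * (u i)%:Z))
      * laurent_s ^ (mdeg u)%:Z.
Proof.
have t_neq0 j : laurent_t (K := K) (d := d) j != 0.
  by rewrite tofrac_eq0 -msupp_eq0 msuppX.
rewrite /toric_map mmapX /mmap1 mdegE.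
have expz_sum j (h : 'I_n -> int) : laurent_t (K := K) (d := d) j ^ (\sum_i h i)
    = \prod_i laurent_t (K := K) j ^ h i.
  by apply: (big_morph _ (fun x y => expfzDr x y (t_neq0 j)) (expr0z _)).
rewrite [X in _ = X * _](eq_bigr _ (fun j _ => expz_sum j _)).
rewrite exchange_big -exprnP -prodrXr -big_split /=; apply: eq_bigr => i _.
by rewrite exprMn -prodrXl; congr (_ * _); apply: eq_bigr => j _; rewrite exprnP exprz_exp.
Qed.

Lemma toric_binomialP (K : fieldType) (d n : nat) (a : 'I_n -> 'rV[int]_d)
    (u v : 'X_{1..n}) :
  toric_ideal (K := K) a ('X_[u] - 'X_[v]) <->
  (forall j, \sum_i a i 0 j * (u i)%:Z = \sum_i a i 0 j * (v i)%:Z)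
    /\ mdeg u = mdeg v.
Proof.
rewrite /toric_ideal /= rmorphB /= !toric_mapX.
split=> [/subr0_eq E|[E1 ->]]; last first.
  by apply/eqP; rewrite subr_eq0; apply/eqP; congr (_ * _); apply: eq_bigr => j _; rewrite E1.
(* The exponents of the t_j and of s, gathered in a single family. *)
pose e (w : 'X_{1..n}) (i : 'I_d.+1) : int :=
  oapp (fun j => \sum_i a i 0 j * (w i)%:Z) (mdeg w)%:Z (unlift ord_max i).
have widenE (j : 'I_d) : widen_ord (leqnSn d) j = lift ord_max j.
  by apply: val_inj; rewrite /= /bump leqNgt ltn_ord.
have e_max w : e w ord_max = (mdeg w)%:Z by rewrite /e unlift_none.
have e_lift w j : e w (widen_ord (leqnSn d) j) = \sum_i a i 0 j * (w i)%:Z.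
  by rewrite /e widenE liftK.
have /laurent_monomial_inj ee : \prod_i (tofrac ('X_i : {mpoly K[d.+1]})) ^ e u i
    = \prod_i (tofrac ('X_i : {mpoly K[d.+1]})) ^ e v i.
  rewrite !big_ord_recr /= !e_max.
  under eq_bigr do rewrite e_lift; under [in RHS]eq_bigr do rewrite e_lift.
  exact: E.
split=> [j|]; first by rewrite -!e_lift ee.
by have := ee ord_max; rewrite !e_max => -[].
Qed.

Lemma ideal_gen_msupp_divisor (K : fieldType) (n : nat) (G : set {mpoly K[n]})
    (f : {mpoly K[n]}) (u : 'X_{1..n}) :
  ideal_gen G f -> u \in msupp f ->
  exists g p, [/\ G g, p \in msupp g & (p <= u)%MM].
Proof.
move=> [k [g [c [Gg ->]]]]; rewrite mcoeff_msupp raddf_sum /= => sum_neq0.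
have [i] : exists i, (c i * g i)@_u != 0.
  apply/existsP; apply: contraNT sum_neq0; rewrite negb_exists => /forallP h0.
  by rewrite big1 // => i _; apply/eqP; have := h0 i; rewrite negbK.
rewrite -mcoeff_msupp => /msuppM_le /allpairsP[[q p] /= [_ gp ->]].
by exists (g i), p; split=> //; apply: lem_addl.
Qed.

(** Either monomial of the binomial may play the role of [p], which is why the sign
    of [g] is left open. *)
Lemma quadratic_binomial_msupp (K : fieldType) (n : nat) (g : {mpoly K[n]})
    (p : 'X_{1..n}) :
  is_quadratic_binomial g -> p \in msupp g ->
  exists q, [/\ p <> q, mdeg p = 2%N, mdeg q = 2%N
    & g = 'X_[p] - 'X_[q] \/ g = 'X_[q] - 'X_[p] ].
Proof.
move=> [[u [v [u_neq_v gE]]] /= /dhomogP g2].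
have /negPf uv : u != v by apply/eqP.
have ug : u \in msupp g.
  by rewrite gE mcoeff_msupp mcoeffB !mcoeffX eqxx (eq_sym v) uv subr0 oner_eq0.
have vg : v \in msupp g.
  by rewrite gE mcoeff_msupp mcoeffB !mcoeffX eqxx uv sub0r oppr_eq0 oner_eq0.
rewrite {1}gE => /msuppB_le; rewrite mem_cat !msuppX !inE.
have v_neq_u : v <> u by move/esym.
case/orP=> /eqP->; [exists v | exists u]; split; rewrite ?(g2 _ ug) ?(g2 _ vg) //.
  by left.
by right.
Qed.

Lemma mdeg2P (n : nat) (p : 'X_{1..n}) :
  mdeg p = 2%N -> exists i j, p = (U_(i) + U_(j))%MM.
Proof.
move=> p2; have [i pi] : exists i, p i != 0%N.
  apply/existsP; apply: contra_eqT p2; rewrite negb_exists => /forallP h0.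
  by rewrite mdegE big1 // => i _; apply/eqP; have := h0 i; rewrite negbK.
have le_ip : (U_(i) <= p)%MM by rewrite lep1mP.
have := submK le_ip; set r := (p - _)%MM => rE.
have : mdeg r = 1%N by have := congr1 mdeg rE; rewrite mdegD mdeg1 p2 addn1 => -[].
move/eqP; rewrite mdeg_eq1 => /existsP[j /eqP rj].
by exists j, i; rewrite -rE rj.
Qed.

Lemma sum_mulU2 (n d : nat) (a : 'I_n -> 'rV[int]_d) (i j : 'I_n) (y : 'I_d) :
  \sum_h a h 0 y * ((U_(i) + U_(j))%MM h)%:Z = (a i + a j) 0 y.
Proof.
under eq_bigr do rewrite mnmDE !mnm1E PoszD mulrDr.
rewrite big_split mxE /=; congr (_ + _).
  rewrite (bigD1 i) //= eqxx mulr1 big1 ?addr0 // => h.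
  by rewrite eq_sym => /negPf->; rewrite mulr0.
rewrite (bigD1 j) //= eqxx mulr1 big1 ?addr0 // => h.
by rewrite eq_sym => /negPf->; rewrite mulr0.
Qed.

(** * Supporting functionals and integer relations *)

Lemma common_denominator (n : nat) (nu : 'I_n -> rat) :
  exists2 D : int, 0 < D &
    exists z : 'I_n -> int, forall i, D%:~R * nu i = (z i)%:~R.
Proof.
exists (\prod_i denq (nu i)); first by apply: prodr_gt0 => i _; apply: denq_gt0.
exists (fun i => (\prod_(j | j != i) denq (nu j)) * numq (nu i)) => i.
by rewrite (bigD1 i) //= [denq _ * _]mulrC !intrM -mulrA numqE [_ * nu i]mulrC.
Qed.

(** Gordan's theorem for the points [b i] outside [C], homogenised by a last
    coordinate 1 and taken modulo the span of the points in [C] (multiplication by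
    [cokermx E] realises this quotient).  A functional on the quotient is constant
    on [C]; a relation in the quotient lifts to an affine relation whose negative
    coefficients are confined to [C].  The last coordinate accounts for the
    equality of degrees. *)
Lemma supporting_functional_or_relation (n d : nat) (b : 'I_n -> 'rV[int]_d)
    (A C : pred 'I_n) : subpred C A ->
  (exists (c : 'cV[rat]_d) (t : rat),
     (forall i, C i -> dotp (map_mx intr (b i)) c = t) /\
     (forall i, A i -> ~~ C i -> dotp (map_mx intr (b i)) c < t)) \/
  (exists u v : 'X_{1..n},
     [/\ u <> v, forall i, u i != 0%N -> C i, forall i, v i != 0%N -> A i,
         forall j, \sum_i b i 0 j * (u i)%:Z = \sum_i b i 0 j * (v i)%:Z
       & mdeg u = mdeg v]).
Proof.
move=> CA.
pose w i : 'rV[rat]_(d + 1) := row_mx (map_mx intr (b i)) 1.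
pose E : 'M[rat]_(n, d + 1) := \matrix_i (if C i then w i else 0).
pose W : pred 'I_n := [pred i | A i && ~~ C i].
have [[c' c_pos]|[mu [mu0 [i0 Wi0 mui0] sum_mu]]] :=
    gordan (fun i => w i *m cokermx E) (enum_uniq W).
  left; pose y : 'cV_(d + 1) := cokermx E *m c'.
  have dot_w i : dotp (w i) y =
      dsubmx y 0 0 - dotp (map_mx intr (b i)) (- usubmx y).
    rewrite /dotp -{1}[y]vsubmxK mul_row_col mul1mx mulmxN.
    by rewrite [LHS]mxE [(- _ : 'M_1) _ _]mxE opprK addrC.
  exists (- usubmx y), (dsubmx y 0 0); split=> i.
    move=> Ci; apply/esym/eqP; rewrite -subr_eq0 -dot_w.
    have -> : w i = row i E by rewrite rowK Ci.
    by rewrite /dotp /y mulmxA -row_mul mulmx_coker row0 mul0mx mxE.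
  move=> Ai nCi; rewrite -subr_gt0 -dot_w /dotp /y mulmxA.
  by apply: c_pos; rewrite mem_enum inE Ai.
right.
move: sum_mu; under eq_bigr do rewrite scalemxAl.
rewrite -mulmx_suml => /eqP; rewrite -submxE => /submxP[D muE].
pose nu i := (if W i then mu i else 0) - (if C i then D 0 i else 0).
have sum_nu : \sum_i nu i *: w i = 0.
  rewrite /nu; under eq_bigr do rewrite scalerBl.
  rewrite sumrB; apply/eqP; rewrite subr_eq0; apply/eqP.
  transitivity (\sum_(i <- enum W) mu i *: w i).
    rewrite big_enum /= [RHS]big_mkcond; apply: eq_bigr => i _.
    by rewrite -[i \in W]/(W i); case: (W i); rewrite ?scale0r.
  rewrite muE mulmx_sum_row; apply: eq_bigr => i _.
  by rewrite rowK; case: ifP; rewrite ?scale0r ?scaler0.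
have [N N_gt0 [z zE]] := common_denominator nu.
have sum_zw : \sum_i (z i)%:~R *: w i = 0.
  under eq_bigr do rewrite -zE -scalerA.
  by rewrite -scaler_sumr sum_nu scaler0.
have sum_zb j : \sum_i b i 0 j * z i = 0.
  apply/eqP; rewrite -(intr_eq0 rat); apply/eqP.
  have := congr1 (fun x : 'rV_(d + 1) => x 0 (lshift 1 j)) sum_zw.
  rewrite summxE mxE => h; rewrite rmorph_sum -[RHS]h; apply: eq_bigr => i _.
  by rewrite rmorphM /= mxE row_mxEl mxE mulrC.
have sum_z : \sum_i z i = 0.
  apply/eqP; rewrite -(intr_eq0 rat); apply/eqP.
  have := congr1 (fun x : 'rV_(d + 1) => x 0 (rshift d 0)) sum_zw.
  rewrite summxE mxE => h; rewrite rmorph_sum -[RHS]h; apply: eq_bigr => i _.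
  by rewrite mxE row_mxEr mxE mulr1.
(* The negative and positive parts of the integer relation [z]. *)
pose u := [multinom absz (Num.min (z i) 0%R) | i < n].
pose v := [multinom absz (Num.max (z i) 0%R) | i < n].
have vu i : (v i)%:Z - (u i)%:Z = z i.
  by rewrite !mnmE; case: (z i) => k /=; rewrite ?subr0 ?sub0r.
have sgn_z i : ((0 < z i) = (0 < nu i)) * ((z i < 0) = (nu i < 0)).
  by rewrite -(ltr0z rat) -(ltrz0 rat) -zE pmulr_rgt0 ?pmulr_rlt0 ?ltr0z.
have nuW i : W i -> nu i = mu i.
  by move=> Wi; rewrite /nu Wi; case/andP: Wi => _ /negPf->; rewrite subr0.
exists u, v; split.
- have Wi : W i0 by rewrite mem_enum in Wi0.
  move=> uv; have := sgn_z i0; rewrite (nuW _ Wi) mui0 -vu uv subrr ltxx.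
  by case.
- move=> i; apply: contraNT => nCi; rewrite mnmE absz_eq0.
  apply/eqP/min_idPr; rewrite leNgt (sgn_z i).2 /nu (negPf nCi) subr0 -leNgt.
  by case: ifP.
- move=> i; apply: contraNT => nAi; rewrite mnmE absz_eq0.
  apply/eqP/max_idPr; rewrite leNgt (sgn_z i).1 /nu /W /= (negPf nAi) /=.
  by rewrite (contraNF (CA i)) // subr0 ltxx.
- move=> j; apply/esym/eqP; rewrite -subr_eq0 -sumrB -[X in _ == X](sum_zb j).
  by apply/eqP/eq_bigr => i _; rewrite -mulrBr vu.
- apply/esym/eqP; rewrite -eqz_nat -subr_eq0 !mdegE !(big_morph Posz PoszD (erefl _)).
  by rewrite -sumrB -[X in _ == X]sum_z; apply/eqP/eq_bigr => i _; rewrite vu.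
Qed.

(** * Cliques and faces *)

Theorem theorem2p3 (K : fieldType) (R : realType) (d m n : nat)
    (P : set 'rV[R]_d) (a : 'I_n -> 'rV[int]_d)
    (P_lattice : lattice_polytope P)
    (edges_primitive : forall F, edge P F -> primitive_segment F)
    (le_mn : (m <= n)%N)
    (a_inj : injective a)
    (a_vertices :
       [set of_lattice (a i) | i in [set i : 'I_n | (i < m)%N]] = vertices P)
    (a_points : [set of_lattice (a i) | i in [set: 'I_n]] = P `&` lattice)
    (quadratic_gen : forall f : {mpoly K[n]},
       is_binomial f -> toric_ideal a f -> first_vars m f ->
       ideal_gen (is_quadratic_binomial `&` toric_ideal a) f) :
  forall C : set 'rV[R]_d, skeleton_clique P C ->
    exists2 F : set 'rV[R]_d, face P F & vertices F = C.
Proof.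
have L_inj : injective (@of_lattice R d).
  move=> x y /matrixP xy; apply/matrixP => i j.
  by apply/(intr_inj (R := R)); have := xy i j; rewrite !mxE.
have points i : (P `&` lattice) (of_lattice (a i)).
  by rewrite -a_points; exists i.
have vertexP v : vertices P v -> exists2 i : 'I_n, (i < m)%N & of_lattice (a i) = v.
  by rewrite -a_vertices => -[i im <-]; exists i.
move=> C cliqueC; have [CV _] := cliqueC.
pose inC (i : 'I_n) := (i < m)%N && `[< C (of_lattice (a i)) >].
have inC_vertex i : inC i -> (i < m)%N by case/andP.
have [[c [t [C_eq V_lt]]]|] := supporting_functional_or_relation a inC_vertex.
  have dotE i : dotp (of_lattice (a i)) (map_mx ratr c)
      = ratr (dotp (map_mx intr (a i)) c) :> R.
    transitivity (map_mx ratr (map_mx intr (a i) *m c) 0 0 : R); last first.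
      by rewrite [LHS]mxE.
    rewrite map_mxM /dotp; congr ((_ *m _) _ _).
    by apply/matrixP => x y; rewrite !mxE rmorph_int.
  apply: (vertices_supporting_face (c := map_mx ratr c) (b := ratr t)) => //.
  - by case: P_lattice.
  - move=> v Cv; have [i im iv] := vertexP v (CV v Cv).
    by rewrite -iv dotE C_eq // /inC im; apply/asboolP; rewrite iv.
  - move=> v Vv nCv; have [i im iv] := vertexP v Vv.
    rewrite -iv dotE ltr_rat V_lt // /inC im /=; apply/asboolP.
    by rewrite iv.
move=> [u [v [u_neq_v uC v_lt_m uv deg_uv]]]; exfalso.
have uv_toric : toric_ideal (K := K) a ('X_[u] - 'X_[v]) by apply/toric_binomialP.
have uv_vars : first_vars (K := K) m ('X_[u] - 'X_[v]).
  move=> e /msuppB_le; rewrite mem_cat !msuppX !inE => /orP[]/eqP-> i le_mi.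
    by apply/eqP; apply: contraLR le_mi => /uC/inC_vertex; rewrite ltnNge.
  by apply/eqP; apply: contraLR le_mi => /v_lt_m; rewrite ltnNge.
have u_supp : u \in msupp ('X_[u] - 'X_[v] : {mpoly K[n]}).
  have /eqP/negPf vu : v <> u by move/esym.
  by rewrite mcoeff_msupp mcoeffB !mcoeffX eqxx vu subr0 oner_eq0.
have uv_gen := quadratic_gen _ (ex_intro _ u (ex_intro _ v (conj u_neq_v erefl)))
  uv_toric uv_vars.
have [g [p [[g_quad g_toric] gp le_pu]]] := ideal_gen_msupp_divisor uv_gen u_supp.
have [q [p_neq_q p2 q2 gE]] := quadratic_binomial_msupp g_quad gp.
have pq j : \sum_i a i 0 j * (p i)%:Z = \sum_i a i 0 j * (q i)%:Z.
  by case: gE g_toric => -> /toric_binomialP[].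
have [i [j pE]] := mdeg2P p2; have [k [l qE]] := mdeg2P q2.
have kl_ij : a k + a l = a i + a j.
  by apply/rowP => y; rewrite -!sum_mulU2 -pE -qE pq.
have kl_ijR : of_lattice (a k) + of_lattice (a l)
    = of_lattice (a i) + of_lattice (a j) :> 'rV[R]_d.
  by rewrite /of_lattice -!map_mxD kl_ij.
have in_C h : p h != 0%N -> C (of_lattice (a h)).
  move=> ph; suff /uC/andP[_ /asboolP//] : u h != 0%N.
  by move/mnm_lepP: le_pu => /(_ h); rewrite -!lt0n in ph *; apply: leq_trans.
have Ci : C (of_lattice (a i)) by apply: in_C; rewrite pE mnmDE !mnm1E eqxx.
have Cj : C (of_lattice (a j)) by apply: in_C; rewrite pE mnmDE !mnm1E eqxx addn1.
have [] := clique_pair_sum edges_primitive cliqueC (points k) (points l) Ci Cj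
  (proj2 (points i)) (proj2 (points j)) kl_ijR.
  move=> /L_inj ki; have lj : a l = a j by apply: (addrI (a k)); rewrite kl_ij ki.
  by apply: p_neq_q; rewrite pE qE (a_inj _ _ ki) (a_inj _ _ lj).
move=> /L_inj kj; have li : a l = a i.
  by apply: (addrI (a k)); rewrite kl_ij kj addrC.
by apply: p_neq_q; rewrite pE qE (a_inj _ _ kj) (a_inj _ _ li) addmC.
Qed.
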